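(* Let $S=\{x_1,\dots,x_n\}$ be a GCD closed set of positive integers in which every element generates a double-chain set in $S$. Then the inertia of the LCM matrix $[S]$ is $(i_+([S]),i_-([S]),i_0([S]))$ with $i_0([S])=0$, $i_-([S])=|\{x_k\in S: |C_S(x_k)|=1\}|$ and $i_+([S])=n-i_-([S])=|\{x_k\in S: |C_S(x_k)|\ne 1\}|$.
   Context: The inertia of a real symmetric matrix $M$ is the triple $(i_+(M),i_-(M),i_0(M))$ of the numbers of positive, negative and zero eigenvalues (with multiplicity). The LCM matrix $[S]$ has $(i,j)$ entry $\mathrm{lcm}(x_i,x_j)$. All order notions are with respect to divisibility, with meet $\gcd$; $S$ is GCD closed if $\gcd(x,y)\in S$ for all $x,y\in S$. $C_S(x)$ is the set of elements of $S$ covered by $x$ in $(S,\mid)$; $\mathrm{meetcl}(C)$ is the set of gcds of all nonempty finite subsets of $C$. An element $x\in S$ generates a double-chain set in $S$ if $\mathrm{meetcl}(C_S(x))\setminus C_S(x)$ is a union of two disjoint (possibly empty) chains under divisibility. *)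

(* Defs.v *)
From HB Require Import structures.
From mathcomp Require Import all_boot all_order all_algebra all_field.
Set Implicit Arguments. Unset Strict Implicit. Unset Printing Implicit Defensive.
Import Order.TTheory GRing.Theory Num.Theory.

Local Open Scope ring_scope.

(* The eigenvalues of A, listed with (algebraic) multiplicity: the roots of the
   characteristic polynomial over the algebraically closed field algC.  Since
   char_poly A is monic (nonzero), this list is unique up to permutation. *)
Definition eigenvalues (n : nat) (A : 'M[algC]_n) : seq algC :=
  sval (closed_field_poly_normal (char_poly A)).

Definition inertia_pos (n : nat) (A : 'M[algC]_n) : nat :=
  count (fun z : algC => 0 < z) (eigenvalues A).
Definition inertia_neg (n : nat) (A : 'M[algC]_n) : nat :=
  count (fun z : algC => z < 0) (eigenvalues A).
Definition inertia_zero (n : nat) (A : 'M[algC]_n) : nat :=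
  count (fun z : algC => z == 0) (eigenvalues A).

Definition lcm_matrix (S : seq nat) : 'M[algC]_(size S) :=
  \matrix_(i < size S, j < size S) (lcmn (nth 0%N S i) (nth 0%N S j))%:R.

Local Close Scope ring_scope.

Definition gcd_closed (S : seq nat) : Prop :=
  forall x y, x \in S -> y \in S -> gcdn x y \in S.

Definition covered (S : seq nat) (x : nat) : seq nat :=
  [seq y <- S | [&& y %| x, y != x &
     ~~ has (fun z => [&& y %| z, z %| x, z != y & z != x]) S]].

Definition meetcl (C : seq nat) (m : nat) : Prop :=
  exists T : seq nat, T <> [::] /\ {subset T <= C} /\ m = \big[gcdn/0]_(t <- T) t.

Definition is_chain (D : nat -> Prop) : Prop :=
  forall a b, D a -> D b -> a %| b \/ b %| a.

Definition generates_double_chain (S : seq nat) (x : nat) : Prop :=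
  exists D1 D2 : nat -> Prop,
    [/\ is_chain D1, is_chain D2, (forall m, ~ (D1 m /\ D2 m)) &
        (forall m, (meetcl (covered S x) m /\ m \notin covered S x) <-> (D1 m \/ D2 m))].

(* Main.v *)
Require Import Defs.
From HB Require Import structures.
From mathcomp Require Import all_boot all_order all_algebra all_field.
From mathcomp Require Import zify ring.

Set Implicit Arguments. Unset Strict Implicit. Unset Printing Implicit Defensive.
Import Order.TTheory GRing.Theory Num.Theory.

(* Let psi be the function with sum_(d in S, d | x) psi d = 1/x for x in S.
   Since lcm(x, y) = x y / gcd(x, y) and S is gcd closed, [S] is congruent to
   the diagonal matrix of the values of psi, so only their signs matter.  One
   has psi x = 1/x - N (C_S(x)), where N C sums psi over the d in S dividing
   some element of C.  If |C_S(x)| <= 1 the sign is clear.  If C = C_S(x) has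
   several elements, N C < 0: the two chains provide y in C such that the
   gcds of y with the rest of C have a maximum z, hence
   N C = N (C \ {y}) + 1/y - 1/z with z < y, and one removes elements until
   only two, a and b, remain, where 1/a + 1/b < 1/gcd(a, b). *)

(** * Chains of gcds and a maximal gcd *)

Lemma exists_argmax (T : eqType) (f : T -> nat) (s : seq T) (x0 : T) :
  x0 \in s -> exists2 x, x \in s & forall y, y \in s -> f y <= f x.
Proof.
move=> x0s; have s_gt0 : 0 < size s by case: (s) x0s.
pose i := [arg max_(i > Ordinal s_gt0) f (nth x0 s i)].
exists (nth x0 s i) => [|y ys]; first exact: mem_nth.
have /= := ys; rewrite -index_mem => lt_y.
rewrite /i; case: arg_maxnP => // j _ /(_ (Ordinal lt_y) isT).
by rewrite /= nth_index.
Qed.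

Lemma leq_chain_dvdn a b : 0 < a -> a <= b -> a %| b \/ b %| a -> a %| b.
Proof.
move=> a_gt0 le_ab [//|dvd_ba]; have := dvdn_leq a_gt0 dvd_ba => le_ba.
by rewrite (@anti_leq a b) ?le_ab.
Qed.

(** Membership in the chains is a mere proposition, so a boolean choice between them is built
    element by element along the finite list [s]. *)
Lemma two_chains_coloring (D1 D2 : nat -> Prop) (s : seq nat) :
  is_chain D1 -> is_chain D2 -> (forall m, m \in s -> D1 m \/ D2 m) ->
  exists col : nat -> bool, forall a b, a \in s -> b \in s ->
    col a = col b -> a %| b \/ b %| a.
Proof.
move=> D1_chain D2_chain sD.
suff [col colP] : exists col : nat -> bool,
    forall m, m \in s -> if col m then D1 m else D2 m.
  exists col => a b /colP + /colP; case: (col a) (col b) => [] [] // Da Db _.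
    exact: D1_chain.
  exact: D2_chain.
elim: s sD => [|m s IHs] sD; first by exists xpredT.
have [|col colP] := IHs; first by move=> a as_; apply: sD; rewrite inE as_ orbT.
have [|D1m|D2m] := sD m; first exact: mem_head.
  exists (fun a => (a == m) || col a) => a; rewrite inE.
  by case: eqP => [->|] //= _ /colP.
exists (fun a => (a != m) && col a) => a; rewrite inE.
by case: eqP => [->|] //= _ /colP.
Qed.

(** A boolean form of the double-chain condition that passes to subsets of [C], and so survives the
    removal of elements. *)
Definition colored_gcds (col : nat -> bool) (C : seq nat) : Prop :=
  forall a b a' b', a \in C -> b \in C -> a' \in C -> b' \in C ->
    a != b -> a' != b' -> col (gcdn a b) = col (gcdn a' b') ->
    gcdn a b %| gcdn a' b' \/ gcdn a' b' %| gcdn a b.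

(* Take y minimizing h y, the largest gcd of the first color of y with another
   element, and c maximizing gcd(y, c) among the gcds of the second color.  A
   gcd of the first color of y is at most h y <= h c, so it divides h c, hence
   c, hence gcd(y, c). *)
Lemma exists_max_gcd (col : nat -> bool) (C : seq nat) :
  uniq C -> 1 < size C -> (forall a, a \in C -> 0 < a) -> colored_gcds col C ->
  exists y c, [/\ y \in C, c \in C, c != y &
    forall c', c' \in C -> c' != y -> gcdn y c' %| gcdn y c].
Proof.
move=> C_uniq C_gt1 C_gt0 C_col.
pose h y := \max_(c <- C | (c != y) && col (gcdn y c)) gcdn y c.
have [y yC y_min] : exists2 y, y \in C & forall c, c \in C -> h y <= h c.
  have [x0 x0C] : exists x0, x0 \in C.
    by case: (C) C_gt1 => // x0 ?; exists x0; exact: mem_head.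
  (* [h] is minimized by maximizing [M - h c], where [h c <= M] keeps the truncated subtraction
     faithful. *)
  pose M := \max_(c <- C) h c.
  have hM c : c \in C -> h c <= M by move=> cC; exact: leq_bigmax_seq.
  have [y yC y_max] := exists_argmax (fun c => M - h c) x0C.
  by exists y => // c cC; have := y_max _ cC; have := hM _ cC; have := hM _ yC; lia.
pose L := [seq c <- C | c != y]; pose L2 := [seq c <- L | ~~ col (gcdn y c)].
have LP c : (c \in L) = (c != y) && (c \in C) by rewrite mem_filter.
have gcd_gt0 c : 0 < gcdn y c by rewrite gcdn_gt0 C_gt0.
have max_col (s : seq nat) c : {subset s <= L} -> c \in s ->
    (forall c', c' \in s -> gcdn y c' <= gcdn y c) ->
    forall c', c' \in s -> col (gcdn y c') = col (gcdn y c) ->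
    gcdn y c' %| gcdn y c.
  move=> sL cs c_max c' c's col_eq.
  have := sL _ cs; have := sL _ c's; rewrite !LP => /andP[c'y c'C] /andP[cy cC].
  by apply: leq_chain_dvdn => //; [exact: c_max | apply: C_col; rewrite // eq_sym].
(* If all gcds of [y] have the first color, they form one chain, and the largest is a multiple of
   all the others. *)
have [L2_nil|[c1 c1L2]] : L2 = [::] \/ exists c, c \in L2.
  by case: (L2) => [|c1 s]; [left | right; exists c1; exact: mem_head].
- have L_col c : c \in L -> col (gcdn y c).
    move=> cL; have : c \notin L2 by rewrite L2_nil.
    by rewrite mem_filter cL andbT negbK.
  have [c0 c0L] : exists c0, c0 \in L.
    have : size L = (size C).-1.
      by rewrite size_filter -(size_rem yC) (rem_filter _ C_uniq) size_filter.
    case: (L) => [|c0 s]; first by case: (C) C_gt1 => [|? []].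
    by exists c0; exact: mem_head.
  have [c cL c_max] := exists_argmax (gcdn y) c0L.
  have := cL; rewrite LP => /andP[cy cC].
  exists y, c; split => // c' c'C c'y.
  have c'L : c' \in L by rewrite LP c'y.
  by apply: (max_col L) => //; rewrite !L_col.
have [c cL2 c_max] := exists_argmax (gcdn y) c1L2.
have := cL2; rewrite mem_filter LP => /and3P[c_col cy cC].
exists y, c; split => // c' c'C c'y.
have [c'_col|c'_col] := boolP (col (gcdn y c')); last first.
  apply: (max_col L2) => //; rewrite ?mem_filter ?c'_col ?c'y //.
    by move=> a; rewrite mem_filter => /andP[].
  by rewrite (negbTE c'_col) (negbTE c_col).
have le_c'_hc : gcdn y c' <= h c.
  by apply: leq_trans (y_min _ cC); apply: leq_bigmax_seq => //; rewrite c'y.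
pose K := [seq e <- C | (e != c) && col (gcdn c e)].
have [K_nil|[e1 e1K]] : K = [::] \/ exists e, e \in K.
  by case: (K) => [|e1 s]; [left | right; exists e1; exact: mem_head].
  (* For empty [K], [h c] is an empty maximum, hence 0, although it bounds the positive
     [gcdn y c']. *)
  by have := leq_trans (gcd_gt0 c') le_c'_hc; rewrite /h -big_filter -/K K_nil big_nil.
have [e eK e_max] := exists_argmax (gcdn c) e1K.
have := eK; rewrite mem_filter => /andP[/andP[ec e_col] eC].
have le_hc_e : h c <= gcdn c e.
  by rewrite /h -big_filter -/K; apply/bigmax_leqP_seq => a aK _; exact: e_max.
rewrite dvdn_gcd dvdn_gcdl; apply: dvdn_trans (dvdn_gcdl c e).
apply: leq_chain_dvdn => //; first exact: leq_trans le_hc_e.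
by apply: C_col; rewrite 1?eq_sym //= c'_col e_col.
Qed.

(** * Inversion of divisor sums and the sign of [psi] *)

Local Open Scope ring_scope.

Lemma sum_divisorsD1 (V : zmodType) (f : nat -> V) (S : seq nat) x :
  uniq S -> x \in S ->
  \sum_(d <- S | (d %| x)%N) f d =
    f x + \sum_(d <- S | (d %| x)%N && (d != x)) f d.
Proof.
move=> S_uniq xS; rewrite big_mkcond (bigD1_seq x) //= dvdnn; congr (_ + _).
rewrite big_mkcond [RHS]big_mkcond; apply: eq_bigr => d _.
by case: (d %| x)%N; case: (d != x).
Qed.

(** Möbius inversion on [S]: values are fixed in increasing order. Setting the one at [n] disturbs
    no sum at a smaller [x], since divisors of a positive [x] are at most [x]. *)
Lemma exists_divisor_sum (V : zmodType) (f : nat -> V) (S : seq nat) :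
  uniq S -> (forall x, x \in S -> (0 < x)%N) ->
  exists psi : nat -> V, forall x, x \in S -> \sum_(d <- S | (d %| x)%N) psi d = f x.
Proof.
move=> S_uniq S_gt0.
suff exn : forall n, exists psi : nat -> V, forall x, x \in S -> (x < n)%N ->
    \sum_(d <- S | (d %| x)%N) psi d = f x.
  have [psi psiP] := exn (\max_(x <- S) x).+1; exists psi => x xS.
  by apply: psiP => //; rewrite ltnS (@leq_bigmax_seq _ S xpredT id).
elim=> [|n [psi psiP]]; first by exists (fun=> 0).
pose v := f n - \sum_(d <- S | (d %| n)%N && (d != n)) psi d.
exists (fun d => if d == n then v else psi d) => x xS.
have x_gt0 := S_gt0 _ xS.
rewrite ltnS leq_eqVlt => /orP[/eqP xn|lt_xn].
  rewrite sum_divisorsD1 // -xn eqxx /v -xn -[RHS](subrK (\sum_(d <- S |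
    (d %| x)%N && (d != x)) psi d)); congr (_ + _).
  by apply: eq_bigr => d /andP[_ /negbTE ->].
rewrite -psiP //; apply: eq_bigr => d d_dvd; case: eqP => // dn.
by have := dvdn_leq x_gt0 d_dvd; rewrite dn leqNgt lt_xn.
Qed.

(** With a = u g and b = v g, the claim becomes u + v < u v, which holds for distinct u, v >= 2. *)
Lemma addf_inv_lt_gcd (F : numFieldType) (a b : nat) : (0 < a)%N -> (0 < b)%N ->
  ~~ (a %| b)%N -> ~~ (b %| a)%N ->
  a%:R^-1 + b%:R^-1 < (gcdn a b)%:R^-1 :> F.
Proof.
move=> a_gt0 b_gt0 Nab Nba; have g_gt0 : (0 < gcdn a b)%N by rewrite gcdn_gt0 a_gt0.
move: (gcdn a b) g_gt0 (dvdn_gcdl a b) (dvdn_gcdr a b) => g g_gt0.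
move=> /dvdnP[u au] /dvdnP[v bv]; subst a b.
have [u_gt0 v_gt0] : (0 < u)%N /\ (0 < v)%N by split; lia.
have u_neq1 : u != 1%N by apply: contra Nab => /eqP ->; rewrite mul1n dvdn_mull.
have v_neq1 : v != 1%N by apply: contra Nba => /eqP ->; rewrite mul1n dvdn_mull.
have u_neqv : u != v by apply: contra Nab => /eqP ->.
have lt_uv : (u + v < u * v)%N by nia.
have [u0 v0 g0] : [/\ u%:R != 0 :> F, v%:R != 0 :> F & g%:R != 0 :> F].
  by rewrite !pnatr_eq0 -!lt0n.
rewrite -subr_gt0 (_ : _ - _ = (u%:R * v%:R - (u%:R + v%:R)) / (u%:R * v%:R * g%:R)).
  by rewrite divr_gt0 ?mulr_gt0 ?ltr0n // subr_gt0 -natrM -natrD ltr_nat.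
by rewrite !natrM; field; rewrite u0 v0 g0.
Qed.

Section DivisorSums.
Variables (F : numFieldType) (S : seq nat) (psi : nat -> F).
Hypothesis S_uniq : uniq S.
Hypothesis S_gt0 : forall x, x \in S -> (0 < x)%N.
Hypothesis S_gcd : gcd_closed S.
Hypothesis psiP : forall x, x \in S -> \sum_(d <- S | (d %| x)%N) psi d = x%:R^-1.

Definition down_sum (C : seq nat) : F := \sum_(d <- S | has (dvdn d) C) psi d.

Lemma down_sum1 y : y \in S -> down_sum [:: y] = y%:R^-1.
Proof. by move=> /psiP <-; apply: eq_bigl => d; rewrite /= orbF. Qed.

(** Inclusion-exclusion with a single correction term: by maximality, the [d] dividing both [y] and
    some element of [C] are the divisors of [gcdn y c], which lies in [S]. *)
Lemma down_sum_cons y c (C : seq nat) :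
  y \in S -> c \in S -> c \in C ->
  (forall c', c' \in C -> gcdn y c' %| gcdn y c)%N ->
  down_sum (y :: C) = down_sum C + (y%:R^-1 - (gcdn y c)%:R^-1).
Proof.
move=> yS cS cC c_max; rewrite -!psiP ?S_gcd // /down_sum.
rewrite [LHS]big_mkcond [X in _ = X + _]big_mkcond [X in X - _]big_mkcond.
rewrite [X in _ - X]big_mkcond -sumrB -big_split /=.
apply: eq_bigr => d _; rewrite dvdn_gcd.
have [dy|dy] /= := boolP (d %| y)%N; last by rewrite subrr addr0.
have -> : (d %| c)%N = has (dvdn d) C.
  apply/idP/hasP => [dc|[c' c'C dc']]; first by exists c.
  apply: dvdn_trans (dvdn_gcdr y c); apply: dvdn_trans (c_max _ c'C).
  by rewrite dvdn_gcd dy.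
by case: has; rewrite ?subrr ?addr0 // subr0 add0r.
Qed.

Lemma down_sum_lt0 (col : nat -> bool) (C : seq nat) :
  uniq C -> {subset C <= S} -> (1 < size C)%N ->
  {in C &, forall a b, a != b -> ~~ (a %| b)%N} -> colored_gcds col C ->
  down_sum C < 0.
Proof.
have [n] := ubnP (size C); elim: n C => // n IHn C ltCn C_uniq CS C_gt1 C_anti C_col.
have C_gt0 a : a \in C -> (0 < a)%N by move/CS/S_gt0.
have [y [c [yC cC cy c_max]]] := exists_max_gcd C_uniq C_gt1 C_gt0 C_col.
pose C' := rem y C.
have C'P a : (a \in C') = (a != y) && (a \in C) by rewrite mem_rem_uniq.
have C'C : {subset C' <= C} by move=> a; rewrite C'P => /andP[].
have cC' : c \in C' by rewrite C'P cy.
have -> : down_sum C = down_sum (y :: C').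
  by apply: eq_bigl => d; apply: eq_has_r => a; apply/perm_mem/perm_to_rem.
rewrite (@down_sum_cons y c) ?CS //; last first.
  by move=> c'; rewrite C'P => /andP[c'y c'C]; exact: c_max.
have C'_size : size C' = (size C).-1 by rewrite size_rem.
have [C'_gt1|C'_le1] := ltnP 1 (size C').
  (* Both summands are negative; in the difference, [gcdn y c = y] would make [y] divide [c],
     against the antichain condition. *)
  rewrite addrC -[ltRHS]addr0 ltrD //.
    rewrite subr_lt0 ltf_pV2 ?posrE ?ltr0n ?gcdn_gt0 ?C_gt0 // ltr_nat.
    rewrite ltn_neqAle dvdn_leq ?dvdn_gcdl ?C_gt0 // andbT.
    apply: contra (C_anti _ _ yC cC _); last by rewrite eq_sym.
    by move=> /eqP <-; rewrite dvdn_gcdr.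
  apply: IHn; rewrite ?rem_uniq //; first by rewrite C'_size; lia.
  - by move=> a /C'C /CS.
  - by move=> a b /C'C aC /C'C; exact: C_anti.
  - by move=> a b a' b' /C'C aC /C'C bC /C'C a'C /C'C; exact: C_col.
have -> : C' = [:: c].
  by move: C'_le1 cC'; case: (C') => [|c0 []] //= _; rewrite inE => /eqP ->.
rewrite down_sum1 ?CS // addrA subr_lt0 addrC.
by apply: addf_inv_lt_gcd; rewrite ?C_gt0 //; apply: C_anti; rewrite // eq_sym.
Qed.

Lemma mem_covered x y : y \in covered S x -> [/\ y \in S, (y %| x)%N & y != x].
Proof. by rewrite mem_filter => /andP[/and3P[]]. Qed.

Lemma covered_antichain x : {in covered S x &, forall a b, a != b -> ~~ (a %| b)%N}.
Proof.
move=> a b; rewrite mem_filter => /andP[/and3P[_ _ /hasPn a_cov] _].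
move=> /mem_covered[bS bx b_neqx] ab; apply/negP => dvd_ab.
by have := a_cov _ bS; rewrite dvd_ab bx eq_sym ab b_neqx.
Qed.

Lemma exists_covered x d : x \in S -> d \in S -> (d %| x)%N -> d != x ->
  has (dvdn d) (covered S x).
Proof.
move=> xS dS dx d_neqx.
(* The largest element of [B] is covered by [x]: anything strictly between would be a larger member
   of [B]. *)
pose B := [seq z <- S | [&& d %| z, z %| x & z != x]%N].
have dB : d \in B by rewrite mem_filter dvdnn dx d_neqx.
have [y] := exists_argmax id dB.
rewrite mem_filter => /andP[/and3P[dy yx y_neqx] yS] y_max.
apply/hasP; exists y => //; rewrite mem_filter yS yx y_neqx andbT /=.
apply/hasPn => z zS; apply/negP => /and4P[yz zx z_neqy z_neqx].
have /y_max : z \in B by rewrite mem_filter zS zx z_neqx (dvdn_trans dy yz).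
by rewrite leqNgt ltn_neqAle eq_sym z_neqy dvdn_leq ?S_gt0.
Qed.

(** The proper divisors of [x] in [S] are exactly the elements of [S] dividing some element covered
    by [x]. *)
Lemma psi_covered x : x \in S -> psi x = x%:R^-1 - down_sum (covered S x).
Proof.
move=> xS; rewrite -psiP // sum_divisorsD1 // -[LHS](addrK (\sum_(d <- S |
  (d %| x)%N && (d != x)) psi d)); congr (_ - _).
rewrite /down_sum big_seq_cond [RHS]big_seq_cond; apply: eq_bigl => d.
have [dS|] //= := boolP (d \in S).
apply/andP/idP => [[]|/hasP[c /mem_covered[cS cx c_neqx] dc]].
  exact: exists_covered.
split; first exact: dvdn_trans cx.
apply: contra c_neqx => /eqP dx.
by rewrite eqn_dvd cx -dx dc.
Qed.

(** Covered elements form an antichain, so the gcd of two distinct ones is not itself covered and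
    falls in one of the two chains. *)
Lemma double_chain_colored_gcds x : generates_double_chain S x ->
  exists col, colored_gcds col (covered S x).
Proof.
move=> [D1 [D2 [D1_chain D2_chain _ D12]]]; set C := covered S x.
pose G := [seq gcdn a b | a <- C, b <- [seq b <- C | a != b]].
have GP a b : a \in C -> b \in C -> a != b -> gcdn a b \in G.
  by move=> aC bC ab; apply/allpairsPdep; exists a, b; rewrite mem_filter ab.
have [|col colP] := @two_chains_coloring D1 D2 G D1_chain D2_chain.
  move=> m /allpairsPdep[a [b [aC]]]; rewrite mem_filter => /andP[ab bC] ->.
  apply/D12; split.
    exists [:: a; b]; split => //; split.
      by move=> c; rewrite !inE => /orP[] /eqP ->.
    by rewrite !big_cons big_nil gcdn0.
  apply/negP => gC; have [g_eqa|g_neqa] := eqVneq (gcdn a b) a.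
    by have := covered_antichain aC bC ab; rewrite -{1}g_eqa dvdn_gcdr.
  by have := covered_antichain gC aC g_neqa; rewrite dvdn_gcdl.
by exists col => a b a' b' aC bC a'C b'C ab a'b'; apply: colP; exact: GP.
Qed.

Lemma psi_sign x : x \in S -> generates_double_chain S x ->
  if size (covered S x) == 1%N then psi x < 0 else 0 < psi x.
Proof.
move=> xS /double_chain_colored_gcds[col C_col]; rewrite psi_covered //.
have x_gt0 := S_gt0 xS.
have C_uniq : uniq (covered S x) by exact: filter_uniq.
have C_sub : {subset covered S x <= S} by move=> y /mem_covered[].
case: (ltngtP (size (covered S x)) 1) => [||C1].
- rewrite ltnS leqn0 => /nilP ->; rewrite /down_sum big_pred0_eq subr0.
  by rewrite invr_gt0 ltr0n.
- move=> C_gt1; rewrite subr_gt0 (lt_trans (_ : _ < 0)) ?invr_gt0 ?ltr0n //.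
  exact: (down_sum_lt0 C_uniq C_sub C_gt1 (@covered_antichain x) C_col).
have [y CE] : exists y, covered S x = [:: y].
  by case: (covered S x) C1 => [|y []] // _; exists y.
have [yS yx y_neqx] : [/\ y \in S, (y %| x)%N & y != x].
  by apply: mem_covered; rewrite CE mem_head.
rewrite CE down_sum1 // subr_lt0 ltf_pV2 ?posrE ?ltr0n ?S_gt0 // ltr_nat.
by rewrite ltn_neqAle y_neqx dvdn_leq.
Qed.

End DivisorSums.

(** * Eigenvalue counts and Sylvester's law of inertia *)

Local Open Scope sesquilinear_scope.

Lemma mul_diag_adjE (C : numClosedFieldType) n (b w : 'rV[C]_n) :
  (w *m diag_mx b *m w^t*) 0 0 = \sum_j b 0 j * `|w 0 j| ^+ 2.
Proof.
rewrite mxE; apply: eq_bigr => j _.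
by rewrite mul_mx_diag !mxE normCK mulrA [b 0 j * _]mulrC.
Qed.

(** One half of Sylvester's law, by counting dimensions. Otherwise some nonzero [v] supported on [P]
    is sent by [W] to a [w] vanishing on [Q]; the common value of the two forms is then positive by
    [a] and at most 0 by [b]. *)
Lemma card_pos_diag_le (C : numClosedFieldType) m n
    (W : 'M[C]_(m, n)) (a : 'rV[C]_m) (b : 'rV[C]_n) :
  b \is a realmx -> diag_mx a = W *m diag_mx b *m W^t* ->
  (#|[set i | (0 < a 0 i)%R]| <= #|[set j | (0 < b 0 j)%R]|)%N.
Proof.
move=> b_real aE; set P := [set i | _]; set Q := [set j | _].
rewrite leqNgt; apply/negP => ltQP.
pose f (i : 'I_#|P|) := enum_val i; have f_inj : injective f by exact: enum_val_inj.
(* This block of [W] has more rows than columns, hence a nonzero left kernel. *)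
pose M := \matrix_(i < #|P|, j < #|Q|) W (f i) (enum_val j).
have /rowV0Pn[v /sub_kermxP vM0 v_neq0] : kermx M != 0.
  by rewrite kermx_eq0 -row_leq_rank -ltnNge (leq_ltn_trans (rank_leq_col M)).
pose w := v *m rowsub f W.
have wE : w *m diag_mx b *m w^t* = v *m diag_mx (\row_i a 0 (f i)) *m v^t*.
  rewrite /w trmx_mul map_mxM !mulmxA; congr (_ *m _); rewrite -!mulmxA.
  congr (_ *m _); apply/matrixP => i j.
  have /matrixP/(_ (f i) (f j)) := aE.
  rewrite -mulmxA !mxE (inj_eq f_inj) => ->.
  by apply: eq_bigr => k _; rewrite !mul_diag_mx !mxE.
have w0 j : j \in Q -> w 0 j = 0.
  move=> Qj; have /rowP/(_ (enum_rank_in Qj j)) := vM0; rewrite !mxE => vMj.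
  by rewrite -[RHS]vMj; apply: eq_bigr => i _; rewrite !mxE enum_rankK_in.
have /(congr1 (fun X : 'M_1 => X 0 0)) := wE; rewrite !mul_diag_adjE => sumE.
have [k vk_neq0] : exists k, v 0 k != 0.
  by apply/existsP; rewrite -negb_forall; apply: contra v_neq0 => /forallP v0;
    apply/eqP/rowP => k; rewrite mxE; apply/eqP.
have a_gt0 i : 0 < a 0 (f i) by have := enum_valP i; rewrite inE.
have: 0 < \sum_i (\row_i a 0 (f i)) 0 i * `|v 0 i| ^+ 2.
  rewrite (bigD1 k) //= ltr_pwDl ?sumr_ge0 // => [|i _]; rewrite mxE.
    by rewrite mulr_gt0 // exprn_gt0 ?normr_gt0.
  by rewrite mulr_ge0 ?exprn_ge0 // ltW.
rewrite -sumE => /lt_geF/negP; apply; rewrite -oppr_ge0 -sumrN sumr_ge0 // => j _.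
case: (boolP (j \in Q)) => [/w0 ->|]; first by rewrite normr0 expr0n mulr0 oppr0.
rewrite inE -real_leNgt ?real0 ?(mxOverP b_real) // => b_le0.
by rewrite -mulNr mulr_ge0 ?oppr_ge0 ?exprn_ge0.
Qed.

Lemma char_poly_conj (F : fieldType) n (P A : 'M[F]_n) :
  P \in unitmx -> char_poly (invmx P *m A *m P) = char_poly A.
Proof.
move=> P_unit; rewrite /char_poly /char_poly_mx !map_mxM /=.
have P1 : map_mx polyC (invmx P) *m map_mx polyC P = 1%:M :> 'M[{poly F}]_n.
  by rewrite -map_mxM mulVmx // map_mx1.
rewrite (_ : _ - _ = map_mx polyC (invmx P) *m ('X%:M - map_mx polyC A) *m
   map_mx polyC P); last first.
  by rewrite mulmxBr mulmxBl mul_mx_scalar -scalemxAl P1 scalemx1.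
by rewrite !det_mulmx mulrAC -det_mulmx P1 det1 mul1r.
Qed.

(** By the spectral theorem both lists are the roots of the characteristic polynomial, and a product
    of monic linear factors determines its roots up to order. *)
Lemma eigenvalues_spectral_diag n (A : 'M[algC]_n) : A \is hermsymmx ->
  perm_eq (eigenvalues A) [seq spectral_diag A 0 i | i <- enum 'I_n].
Proof.
move=> /hermitian_normalmx/orthomx_spectralP AE; apply: prod_XsubC_eq.
rewrite /eigenvalues; case: closed_field_poly_normal => /= s.
rewrite (monicP (char_poly_monic A)) scale1r => <-.
rewrite {1}AE char_poly_conj ?spectral_unit // char_poly_trig ?diag_mx_is_trig //.
rewrite big_map big_enum /=.
by apply: eq_bigr => i _; rewrite !mxE eqxx mulr1n.
Qed.

Lemma count_eigenvalues n (A : 'M[algC]_n) (p : pred algC) : A \is hermsymmx ->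
  count p (eigenvalues A) = #|[set i | p (spectral_diag A 0 i)]|.
Proof.
move=> A_herm; rewrite (permP (eigenvalues_spectral_diag A_herm)) count_map.
rewrite -sum1_count big_enum_cond /= sum1_card.
by apply: eq_card => i; rewrite !inE.
Qed.

Lemma count_nth_ord (T : Type) (x0 : T) (p : pred T) (s : seq T) :
  count p s = #|[set i : 'I_(size s) | p (nth x0 s i)]|.
Proof.
rewrite -sum1_count (big_nth x0) big_mkord sum1_card.
by apply: eq_card => i; rewrite !inE.
Qed.

(* As d has no zero entry, the lower bounds of card_pos_diag_le on the numbers of
   positive and of negative eigenvalues add up to n, hence are equalities. *)
Lemma inertia_congr_diag n (A Q : 'M[algC]_n) (d : 'rV[algC]_n) :
  A \is hermsymmx -> Q \in unitmx -> A = Q *m diag_mx d *m Q^t* ->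
  (forall i, (0 < d 0 i) || (d 0 i < 0)) ->
  [/\ inertia_zero A = 0%N,
      inertia_neg A = #|[set i | (d 0 i < 0)%R]| &
      inertia_pos A = #|[set i | (0 < d 0 i)%R]|].
Proof.
move=> A_herm Q_unit AE d_sign; rewrite /inertia_zero /inertia_neg /inertia_pos.
have /hermitian_normalmx/orthomx_spectralP := A_herm.
have sp_real := hermitian_spectral_diag_real A_herm.
have sp_unitary := spectral_unitarymx A.
rewrite !count_eigenvalues //; move: (spectral_diag A) sp_real => l l_real.
move: (spectralmx A) sp_unitary => U U_unitary; rewrite invmx_unitary // => AE'.
(* From [A = U^t* *m diag_mx l *m U] and the congruence [AE], this [W] carries [diag_mx l] to
   [diag_mx d]. *)
pose W := invmx Q *m U^t*.
have dE : diag_mx d = W *m diag_mx l *m W^t*.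
  have Q1 : Q^t* *m (invmx Q)^t* = 1%:M.
    by rewrite -map_mxM -trmx_mul mulVmx // trmx1 map_mx1.
  rewrite /W trmx_mul map_mxM /= trmxCK -[diag_mx d](mulKmx Q_unit) -!mulmxA.
  congr (_ *m _); rewrite !mulmxA -AE' AE.
  by rewrite -[RHS]mulmxA Q1 mulmx1.
have pos_le := card_pos_diag_le l_real dE.
(* The positive bound is applied to [- d] and [- l]. *)
have neg_le : (#|[set i | (d 0 i < 0)%R]| <= #|[set i | (l 0 i < 0)%R]|)%N.
  have lN_real : - l \is a realmx.
    by apply/mxOverP => i j; rewrite mxE realN (mxOverP l_real).
  have /(card_pos_diag_le lN_real) : diag_mx (- d) = W *m diag_mx (- l) *m W^t*.
    by rewrite !raddfN /= dE mulNmx.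
  congr (_ <= _)%N; apply: eq_card => i; rewrite !inE mxE oppr_gt0 //.
have d_total : (#|[set i | (0 < d 0 i)%R]| + #|[set i | (d 0 i < 0)%R]| = n)%N.
  rewrite -cardsUI (_ : _ :|: _ = setT) ?cardsT ?card_ord.
    rewrite (_ : _ :&: _ = set0) ?cards0 ?addn0 //.
    by apply/setP => i; rewrite !inE; apply/andP => -[/lt_gtF ->].
  by apply/setP => i; rewrite !inE d_sign.
have l_total : (#|[set i | (l 0 i == 0)%R]| + #|[set i | (0 < l 0 i)%R]| +
    #|[set i | (l 0 i < 0)%R]| = n)%N.
  rewrite -!sum1dep_card [X in (X + _ + _)%N]big_mkcond [X in (_ + X + _)%N]big_mkcond.
  rewrite [X in (_ + _ + X)%N]big_mkcond -!big_split /=.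
  rewrite -[RHS]card_ord -sum1_card; apply: eq_bigr => i _.
  have : l 0 i \is Num.real by apply/mxOverP.
  by move=> l_i; case: real_ltgtP.
move: pos_le neg_le d_total l_total.
set dp := #|[set i | 0 < d 0 i]|; set dn := #|[set i | d 0 i < 0]|.
set lp := #|[set i | 0 < l 0 i]|; set ln := #|[set i | l 0 i < 0]|.
by set lz := #|[set i | l 0 i == 0]|; clearbody dp dn lp ln lz; split; lia.
Qed.

(** * Factorization of the LCM matrix and conclusion *)

Definition divisor_factor (S : seq nat) : 'M[algC]_(size S) :=
  \matrix_(i, j) ((nth 0%N S i)%:R * (nth 0%N S j %| nth 0%N S i)%N%:R).

(** The matrix would be triangular if [S] were sorted. Without sorting, a vector killed by the
    transpose is shown to vanish at [i] by strong induction on the element of [S] at index [i]. *)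
Lemma divisor_factor_unit (S : seq nat) : uniq S ->
  (forall x, x \in S -> (0 < x)%N) -> divisor_factor S \in unitmx.
Proof.
move=> S_uniq S_gt0; rewrite -unitmx_tr -row_free_unit; apply: inj_row_free => v v0.
have x_gt0 (i : 'I_(size S)) : (0 < nth 0 S i)%N by apply/S_gt0/mem_nth.
apply/rowP => i; rewrite mxE; have [k] := ubnP (nth 0%N S i).
elim: k i => // k IHk i lt_ik.
have /rowP/(_ i) := v0; rewrite !mxE (bigD1 i) //= !mxE dvdnn mulr1 big1 => [|j ji].
  by move/eqP; rewrite addr0 mulf_eq0 pnatr_eq0 -leqn0 leqNgt x_gt0 orbF => /eqP.
rewrite !mxE; have [x_ji|_] := boolP (_ %| _)%N; last by rewrite !mulr0.
rewrite IHk ?mul0r // -ltnS (leq_trans _ lt_ik) // !ltnS ltn_neqAle dvdn_leq //.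
by rewrite nth_uniq // (inj_eq val_inj) ji.
Qed.

(** Since lcm(x, y) = x y / gcd(x, y) with the gcd in [S], each entry is x y times the sum of [psi]
    over the common divisors of x and y in [S]. *)
Lemma lcm_matrix_congr (S : seq nat) (psi : nat -> algC) :
  (forall x, x \in S -> (0 < x)%N) -> gcd_closed S ->
  (forall x, x \in S -> \sum_(d <- S | (d %| x)%N) psi d = x%:R^-1) ->
  lcm_matrix S = divisor_factor S *m diag_mx (\row_i psi (nth 0%N S i)) *m
    (divisor_factor S)^t*.
Proof.
move=> S_gt0 S_gcd psiP; apply/matrixP => i k; rewrite !mxE.
set x := nth 0%N S i; set y := nth 0%N S k.
have [xS yS] : x \in S /\ y \in S by rewrite !mem_nth.
have [x_gt0 y_gt0] := (S_gt0 _ xS, S_gt0 _ yS).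
transitivity (x%:R * y%:R * \sum_(d <- S | (d %| gcdn x y)%N) psi d).
  rewrite psiP ?S_gcd // -natrM -muln_lcm_gcd natrM mulfK //.
  by rewrite pnatr_eq0 -lt0n gcdn_gt0 x_gt0.
rewrite big_mkcond (big_nth 0%N) big_mkord mulr_sumr; apply: eq_bigr => j _.
rewrite mul_mx_diag !mxE dvdn_gcd -/x -/y rmorphM !rmorph_nat.
case: (_ %| x)%N; case: (_ %| y)%N; rewrite /= ?mulr0 ?mul0r ?mulr1 //.
by rewrite mulrAC.
Qed.

Local Close Scope sesquilinear_scope.
Local Close Scope ring_scope.

Theorem theorem5p1 (S : seq nat) :
  uniq S ->
  (forall x, x \in S -> 0 < x) ->
  gcd_closed S ->
  (forall x, x \in S -> generates_double_chain S x) ->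
  [/\ inertia_zero (lcm_matrix S) = 0,
      inertia_neg (lcm_matrix S) = count (fun x => size (covered S x) == 1) S,
      inertia_pos (lcm_matrix S) = size S - inertia_neg (lcm_matrix S) &
      inertia_pos (lcm_matrix S) = count (fun x => size (covered S x) != 1) S].
Proof.
move=> S_uniq S_gt0 S_gcd S_chain.
have [psi psiP] := exists_divisor_sum (fun x => x%:R^-1 : algC)%R S_uniq S_gt0.
pose d := (\row_(i < size S) psi (nth 0 S i))%R.
have d_sign (i : 'I_(size S)) : if size (covered S (nth 0 S i)) == 1 then (d 0 i < 0)%R
    else (0 < d 0 i)%R.
  have xS : nth 0 S i \in S by exact: mem_nth.
  by rewrite mxE; apply: (psi_sign S_uniq S_gt0 S_gcd psiP xS); exact: S_chain.
have d_neq0 i : ((0 < d 0 i) || (d 0 i < 0))%R.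
  by have := d_sign i; case: ifP => _ ->; rewrite ?orbT.
(* Conjugation fixes the natural number entries, so the symmetry of lcm suffices. *)
have A_herm : (lcm_matrix S \is hermsymmx)%R.
  apply/is_hermitianmxP; rewrite expr0 scale1r; apply/matrixP => i j.
  by rewrite !mxE rmorph_nat lcmnC.
have [i0 i_neg i_pos] := inertia_congr_diag A_herm
  (divisor_factor_unit S_uniq S_gt0) (lcm_matrix_congr S_gt0 S_gcd psiP) d_neq0.
have neg_count : inertia_neg (lcm_matrix S) =
    count (fun x => size (covered S x) == 1) S.
  rewrite i_neg (count_nth_ord 0); apply: eq_card => i; rewrite !inE.
  by have := d_sign i; case: ifP => // _ /lt_gtF.
have pos_count : inertia_pos (lcm_matrix S) =
    count (fun x => size (covered S x) != 1) S.
  rewrite i_pos (count_nth_ord 0); apply: eq_card => i; rewrite !inE.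
  by have := d_sign i; case: ifP => // _ /lt_gtF.
split=> //; rewrite neg_count pos_count.
by rewrite -(count_predC (fun x => size (covered S x) == 1) S) addKn.
Qed.
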